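(* Let $d\ge 4$. Then $c^d(K^d)\le 2d$. Consequently Hadwiger's covering conjecture holds for $K^d$, that is, $c^d(K^d)\le 2^d$, with equality if and only if $K^d$ is a parallelepiped.
   Context: $K^d=\{(x_1,\ldots,x_d)\in\mathbb{R}^d : |x_1|+\cdots+|x_d|\le 1\}$ is the $d$-dimensional crosspolytope. For a convex body $K\subset\mathbb{R}^d$ with non-empty interior, $c^d(K)$ denotes the covering number of $K$: the smallest number of translates of the interior of $K$ whose union covers $K$. Hadwiger's covering conjecture for a convex body $K\subset\mathbb{R}^d$ with non-empty interior asserts that $c^d(K)\le 2^d$, with equality if and only if $K$ is a parallelepiped. *)

(* Defs.v *)
From HB Require Import structures.
From mathcomp Require Import all_boot all_order all_algebra.
From mathcomp Require Import all_classical all_reals all_analysis.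

Set Implicit Arguments.
Unset Strict Implicit.
Unset Printing Implicit Defensive.

Import Order.TTheory GRing.Theory Num.Theory.
Import numFieldNormedType.Exports.

Local Open Scope classical_set_scope.
Local Open Scope ring_scope.

Section Covering.
Variables (R : realType) (d : nat).
Implicit Types (K : set 'rV[R]_d) (n : nat).

Definition crosspolytope : set 'rV[R]_d :=
  [set x : 'rV[R]_d | \sum_(i < d) `|x 0 i| <= 1].

(* Repeated translates are allowed; this does not change the smallest [n]. *)
Definition covered_by_translates K n : Prop :=
  exists t : 'I_n -> 'rV[R]_d,
    K `<=` \bigcup_(i in [set: 'I_n]) [set t i + y | y in interior K].

(* The infimum of a nonempty set of naturals is its minimum; the value is +oo
   exactly when no finite number of translates covers [K]. *)
Definition covering_number K : \bar R :=
  ereal_inf [set (n%:R)%:E | n in covered_by_translates K].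

(* The edge vectors are the rows of the invertible matrix [A], so that
   [l *m A] is the combination of the edges with coefficients [l]; degenerate
   (lower-dimensional) parallelepipeds are excluded. *)
Definition parallelepiped K : Prop :=
  exists (a : 'rV[R]_d) (A : 'M[R]_d), A \in unitmx /\
    K = [set a + l *m A | l in [set l : 'rV[R]_d | forall i, 0 <= l 0 i <= 1]].

Definition hadwiger_covering K : Prop :=
  (covering_number K <= ((2 ^ d)%N%:R)%:E)%E /\
  (covering_number K = ((2 ^ d)%N%:R)%:E <-> parallelepiped K).

End Covering.

Arguments crosspolytope : clear implicits.

(* Main.v *)
Require Import Defs.
From HB Require Import structures.
From mathcomp Require Import all_boot all_order all_algebra.
From mathcomp Require Import all_classical all_reals all_analysis.
From mathcomp Require Import ring lra zify.

Set Implicit Arguments.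
Unset Strict Implicit.
Unset Printing Implicit Defensive.

Import Order.TTheory GRing.Theory Num.Theory.
Import numFieldNormedType.Exports.

Local Open Scope classical_set_scope.
Local Open Scope ring_scope.

(** The crosspolytope is the unit ball of the l1 norm, and its interior
    contains the open unit ball.  A point [x] is pulled strictly inside by
    moving a coordinate that is not too small towards [0]: if
    [`|x 0 i| > 1 / (2 d)], a step of length [1 / d] along the [i]-th axis,
    directed against the sign of [x 0 i], strictly decreases the norm.  If no
    coordinate is that large, the norm of [x] is at most [1 / 2], and as
    [1 / 2 + 1 / d < 1] any step of length [1 / d] stays inside.  So the [2 d]
    translates of the interior by the vectors [+- e_i / d] cover the
    crosspolytope, as soon as [3 <= d] ([covered_crosspolytope]).

    Since [2 d < 2 ^ d], equality in the Hadwiger bound never happens, and it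
    remains to see that the crosspolytope is not a parallelepiped
    ([crosspolytope_not_parallelepiped]).  The two are told apart by a Helly
    property of translates: as intervals do, pairwise meeting translates of a
    parallelepiped have a common point ([parallelepiped_helly]).  The translates
    of the crosspolytope centred at four alternate vertices of the cube
    [[-1/2, 1/2]^3] meet pairwise at the midpoints of their centres, but
    have no common point: the four distances from a point to the centres sum
    to at least [6], because the centres sum to [0], whereas a common point would
    make each of them at most [1]. *)

(** * Covering the crosspolytope *)

Definition l1 (R : realType) (d : nat) (x : 'rV[R]_d) : R :=
  \sum_(i < d) `|x 0 i|.

(** Coordinates within [e] of those of [y] change the l1 norm by at most
    [d * e], which is kept below the slack [1 - l1 y]. *)
Lemma interior_crosspolytope (R : realType) (d : nat) (y : 'rV[R]_d) :
  l1 y < 1 -> interior (crosspolytope R d) y.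
Proof.
move=> y1; apply/nbhs_ballP.
(* The denominator d + 1 keeps the radius positive in dimension 0. *)
pose e := (1 - l1 y) / d.+1%:R.
have e0 : 0 < e by rewrite divr_gt0 ?subr_gt0 ?ltr0n.
exists e => //= z yz; rewrite /crosspolytope /=.
have : \sum_(i < d) `|z 0 i| <= \sum_(i < d) (`|y 0 i| + e).
  apply: ler_sum => i _; have [] := yz => // _ /(_ 0 i) yzi.
  have : `|y 0 i - z 0 i| < e by [].
  rewrite -lerBlDl => ?; apply: le_trans (ltW _); last by eassumption.
  by rewrite distrC; apply: lerB_dist.
move/le_trans; apply; rewrite big_split /= sumr_const card_ord.
rewrite -/(l1 y) -mulr_natr.
have : e * d.+1%:R = 1 - l1 y by rewrite divfK // pnatr_eq0.
rewrite -natr1; lra.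
Qed.

Lemma l1_sub_axis (R : realType) (d : nat) (x : 'rV[R]_d) (c : R) (i : 'I_d) :
  l1 (x - c *: delta_mx 0 i) = l1 x - `|x 0 i| + `|x 0 i - c|.
Proof.
rewrite /l1 (bigD1 i) //= [in RHS](bigD1 i) //= !mxE !eqxx mulr1.
under eq_bigr => j ji do rewrite !mxE (negPf ji) andbF mulr0 subr0.
by ring.
Qed.

Lemma covered_by_card (R : realType) (d : nat) (K : set 'rV[R]_d) (T : finType)
    (t : T -> 'rV[R]_d) :
  (forall x, K x -> exists i, interior K (x - t i)) ->
  covered_by_translates K #|T|.
Proof.
move=> Kt; exists (fun i => t (enum_val i)) => x /Kt[i Ki].
by exists (enum_rank i) => //; exists (x - t i); rewrite // enum_rankK subrKC.
Qed.

Lemma covered_crosspolytope (R : realType) (d : nat) : (3 <= d)%N ->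
  covered_by_translates (crosspolytope R d) (2 * d).
Proof.
move=> d3; have -> : (2 * d)%N = #|{: bool * 'I_d}|.
  by rewrite card_prod card_bool card_ord.
have dr : 3 <= d%:R :> R by rewrite ler_nat.
pose c : R := d%:R^-1.
have dc : d%:R * c = 1 by rewrite mulfV // pnatr_eq0; lia.
have c0 : 0 < c by rewrite invr_gt0; lra.
apply: (covered_by_card
  (t := fun si => ((-1) ^+ nat_of_bool si.1 * c) *: delta_mx 0 si.2)) => x x1.
have {}x1 : l1 x <= 1 by [].
have [[i xi]|small] := pselect (exists i, c / 2 < `|x 0 i|).
  exists (x 0 i < 0, i); apply: interior_crosspolytope => /=.
  rewrite l1_sub_axis.
  suff : `|x 0 i - (-1) ^+ (x 0 i < 0)%R * c| < `|x 0 i| by lra.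
  have [xi0|xi0] := ltrP (x 0 i) 0; rewrite ?expr1 ?expr0 ltr_norml.
    by apply/andP; split; move: xi;
      rewrite (ltr0_norm xi0); lra.
  by apply/andP; split; move: xi;
    rewrite (ger0_norm xi0); lra.
have d0 : (0 < d)%N by lia.
exists (false, Ordinal d0); apply: interior_crosspolytope => /=.
rewrite l1_sub_axis expr0 mul1r.
have x2 : l1 x <= 1 / 2.
  apply: (@le_trans _ _ (\sum_(i < d) c / 2)).
    apply: ler_sum => i _; rewrite leNgt.
    by apply/negP => xi; apply: small; exists i.
  by rewrite sumr_const card_ord -mulr_natl; lra.
have := ler_normB (x 0 (Ordinal d0)) c; rewrite (gtr0_norm c0).
by nra.
Qed.

Lemma covering_number_le (R : realType) (d : nat) (K : set 'rV[R]_d) (n : nat) :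
  covered_by_translates K n -> (covering_number K <= (n%:R)%:E)%E.
Proof. by move=> Kn; apply: ereal_inf_lbound; exists n. Qed.

(** * The crosspolytope is not a parallelepiped *)

(** In the coordinates given by the edges the translates are boxes with unit
    sides, and meeting pairwise means that the shifts differ by at most [1] in
    each coordinate; the coordinatewise maximum of the shifts then lies in all
    the boxes. *)
Lemma parallelepiped_helly (R : realType) (d : nat) (K : set 'rV[R]_d)
    (T : finType) (t0 : T) (c : T -> 'rV[R]_d) : parallelepiped K ->
  (forall i j, exists w, K (w - c i) /\ K (w - c j)) ->
  exists z, forall i, K (z - c i).
Proof.
move=> [a [A [Au ->]]] meet.
pose g i := c i *m invmx A.
have gA i : g i *m A = c i by rewrite mulmxKV.
have g1 i j k : g i 0 k - g j 0 k <= 1.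
  have [w [[l l01 lE] [l' l'01 l'E]]] := meet i j.
  have -> : g i 0 k - g j 0 k = l' 0 k - l 0 k.
    have : (g i - g j) *m A = (l' - l) *m A.
      rewrite !mulmxBl !gA -[l' *m A](addKr a) -[l *m A](addKr a) lE l'E.
      by apply/rowP => m; rewrite !mxE; ring.
    move/(can_inj (mulmxK Au))/rowP/(_ k).
    by rewrite !mxE.
  have := l01 k; have := l'01 k; lra.
pose m : 'rV[R]_d := \row_k g [arg max_(i > t0) g i 0 k]%O 0 k.
exists (a + m *m A) => i; exists (m - g i); last by rewrite mulmxBl gA addrA.
move=> k; rewrite mxE [m 0 k]mxE [(- g i) 0 k]mxE; case: arg_maxP => //= j _ jmax.
by rewrite g1 subr_ge0 jmax.
Qed.

Definition row3 (R : realType) (n : nat) (a b c : R) : 'rV[R]_n.+3 :=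
  \row_i nth 0 [:: a; b; c] i.

Lemma l1_row3 (R : realType) (n : nat) (a b c : R) :
  l1 (row3 n a b c) = `|a| + `|b| + `|c|.
Proof.
rewrite /l1 !big_ord_recl /= !mxE /= big1 ?addr0 ?addrA // => i _.
by rewrite mxE /= nth_nil normr0.
Qed.

Lemma l1_sub_row3_ge (R : realType) (n : nat) (z : 'rV[R]_n.+3) (a b c : R) :
  `|z 0 0 - a| + `|z 0 (lift 0 0) - b| + `|z 0 (lift 0 (lift 0 0)) - c|
  <= l1 (z - row3 n a b c).
Proof.
rewrite /l1 !big_ord_recl /= !mxE /= !addrA lerDl.
by apply: sumr_ge0 => i _.
Qed.

(** The four vertices of [[-1/2, 1/2]^3] with a positive product of signs. *)
Definition alternate_vertex (R : realType) (n : nat) (st : bool * bool) :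
    'rV[R]_n.+3 :=
  row3 n ((-1) ^+ nat_of_bool st.1 / 2) ((-1) ^+ nat_of_bool st.2 / 2)
    ((-1) ^+ nat_of_bool (st.1 (+) st.2) / 2).

(** Two distinct centres differ in exactly two coordinates, each by [1]: their
    l1 distance is [2], and the midpoint is at distance [1] from both. *)
Lemma alternate_translates_meet (R : realType) (n : nat) (p q : bool * bool) :
  exists w, crosspolytope R n.+3 (w - alternate_vertex R n p) /\
            crosspolytope R n.+3 (w - alternate_vertex R n q).
Proof.
exists (2^-1 *: (alternate_vertex R n p + alternate_vertex R n q)).
have half (u v : 'rV[R]_n.+3) : 2^-1 *: (u + v) - u = 2^-1 *: (v - u).
  by apply/rowP => i; rewrite !mxE; lra.
rewrite half [X in _ (2^-1 *: X - _)]addrC half.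
suff close (s t : bool * bool) : l1 (2^-1 *: (alternate_vertex R n s
    - alternate_vertex R n t)) <= 1 by split; apply: close.
have -> : 2^-1 *: (alternate_vertex R n s - alternate_vertex R n t) =
    row3 n (((-1) ^+ nat_of_bool s.1 - (-1) ^+ nat_of_bool t.1) / 4)
      (((-1) ^+ nat_of_bool s.2 - (-1) ^+ nat_of_bool t.2) / 4)
      (((-1) ^+ nat_of_bool (s.1 (+) s.2)
        - (-1) ^+ nat_of_bool (t.1 (+) t.2)) / 4).
  apply/rowP => i; rewrite !mxE.
  by case: (nat_of_ord i) => [|[|[|k]]] /=; rewrite ?nth_nil; lra.
rewrite l1_row3.
have n0 : `|(1 - 1) / 4| = 0 :> R by rewrite subrr mul0r normr0.
have n0' : `|(-1 - -1) / 4| = 0 :> R by rewrite subrr mul0r normr0.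
have n1 : `|(1 - -1) / 4| = 1 / 2 :> R by rewrite ger0_norm; lra.
have n1' : `|(-1 - 1) / 4| = 1 / 2 :> R by rewrite ler0_norm; lra.
by case: s t => [[] []] [[] []]; rewrite /= ?expr1 ?expr0 ?n0 ?n0' ?n1 ?n1'; lra.
Qed.

Lemma crosspolytope_not_parallelepiped (R : realType) (d : nat) :
  (3 <= d)%N -> ~ parallelepiped (crosspolytope R d).
Proof.
case: d => [|[|[|n]]] // _ /(@parallelepiped_helly _ _ _ _ (false, false)).
move=> /(_ _ (@alternate_translates_meet R n))[z zK].
pose x := z 0 0; pose y := z 0 (lift 0 0); pose w := z 0 (lift 0 (lift 0 0)).
have dist s t : `|x - (-1) ^+ nat_of_bool s / 2|
    + `|y - (-1) ^+ nat_of_bool t / 2|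
    + `|w - (-1) ^+ nat_of_bool (s (+) t) / 2| <= 1.
  exact: le_trans (l1_sub_row3_ge _ _ _ _) (zK (s, t)).
(* Bounding each distance below by the scalar product with the signs of the
   centre, the terms in x, y, w cancel over the four centres. *)
have up (u : R) : 1 / 2 - u <= `|u - 1 / 2|.
  by rewrite distrC ler_norm.
have down (u : R) : 1 / 2 + u <= `|u - -1 / 2|.
  by apply: le_trans (ler_norm _); lra.
have := dist false false; have := dist false true.
have := dist true false; have := dist true true.
rewrite /= ?expr0 ?expr1.
have := up x; have := up y; have := up w.
have := down x; have := down y; have := down w.
lra.
Qed.

Theorem corollary1 (R : realType) (d : nat) (hd : (4 <= d)%N) :
  (covering_number (crosspolytope R d) <= ((2 * d)%N%:R)%:E)%E /\
  hadwiger_covering (crosspolytope R d).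
Proof.
have d3 : (3 <= d)%N by exact: ltnW.
have le2d := covering_number_le (covered_crosspolytope R d3).
have lt2d : (covering_number (crosspolytope R d) < ((2 ^ d)%N%:R)%:E)%E.
  apply: le_lt_trans le2d _; rewrite lte_fin ltr_nat.
  case: d d3 {hd} => [|d] // d3; rewrite expnS ltn_pmul2l //.
  elim: d d3 => // d IH; rewrite ltnS leq_eqVlt => /orP[/eqP <- //|/IH].
  by rewrite expnS; lia.
split=> //; split; first exact: ltW.
split=> [E|/(crosspolytope_not_parallelepiped d3)//].
by rewrite E ltxx in lt2d.
Qed.
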